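(* Let $n\ge 1$, let $\pi \in S_n$, and suppose that $\mathrm{shape}(\pi)=\lambda=(\lambda_1,\ldots,\lambda_k)\vdash n$. Then $$\mathrm{bump}(\pi)=\sum_{i} (i-1)\lambda_i .$$
   Context: $S_n$ is the set of permutations $\pi=\pi_1\cdots\pi_n$ (one-line notation) of $\{1,\ldots,n\}$. Robinson–Schensted (RS) correspondence: tableaux are fillings of Young diagrams with distinct positive integers increasing along rows and down columns. To insert $k$ into a tableau $P$ (written $P\leftarrow k$), start with the top row: (I1) if $k$ is greater than or equal to the rightmost entry of the current row, or the current row is empty, append $k$ at the end of that row and stop; (I2) otherwise let $y$ be the leftmost entry of the current row with $k<y$, replace $y$ by $k$ (this is one bump: $k$ has bumped $y$ down a row), set $k:=y$, move down one row and go to (I1). For $\pi\in S_n$ set $(P_0,Q_0)$ to be the pair of empty tableaux and, for $i=0,\ldots,n-1$, let $P_{i+1}=P_i\leftarrow\pi_{i+1}$ and form $Q_{i+1}$ from $Q_i$ by placing $i+1$ in the cell of $P_{i+1}$ not in $P_i$. The RS image of $\pi$ is $(P,Q)=(P_n,Q_n)$; $P$ and $Q$ have a common shape, the partition $\mathrm{shape}(\pi)=(\lambda_1,\lambda_2,\ldots)$ of $n$, where $\lambda_i$ is the length of row $i$. The statistic $\mathrm{bump}(\pi)$ is the total number of bumps that occur when the RS procedure is applied to $\pi$. *)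

(* Defs.v *)
From mathcomp Require Import all_boot all_fingroup.

Set Implicit Arguments.
Unset Strict Implicit.
Unset Printing Implicit Defensive.

(* A tableau is the list of its rows, top row first; mathcomp's [shape] is then
   the list of row lengths. *)
Definition tableau := seq (seq nat).

(* [rs_insert P k] is the tableau P <- k together with the number of bumps
   performed by this insertion. *)
Fixpoint rs_insert (P : tableau) (k : nat) : tableau * nat :=
  if P is r :: P' then
    if (r == [::]) || (last 0 r <= k) then (rcons r k :: P', 0)
    else
      let j := find (fun y => k < y) r in
      let: (P'', b) := rs_insert P' (nth 0 r j) in
      (set_nth 0 r j k :: P'', b.+1)
  else ([:: [:: k]], 0).

Definition rs_step (Pb : tableau * nat) (k : nat) : tableau * nat :=
  let: (P, b) := Pb in
  let: (P', b') := rs_insert P k in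
  (P', b + b').

(* Final insertion tableau and accumulated number of bumps. *)
Definition rs (w : seq nat) : tableau * nat := foldl rs_step ([::], 0) w.

(* 'S_n permutes {0, ..., n-1}; values are shifted to {1, ..., n}. *)
Definition one_line (n : nat) (s : 'S_n) : seq nat :=
  [seq (val (s i)).+1 | i <- enum 'I_n].

Definition rs_shape (n : nat) (s : 'S_n) : seq nat := shape (rs (one_line s)).1.

Definition rs_bump (n : nat) (s : 'S_n) : nat := (rs (one_line s)).2.

(* Main.v *)
Require Import Defs.
From mathcomp Require Import all_boot all_fingroup.

(** The identity holds because it is preserved by every single insertion.
    Each bump moves the insertion down exactly one row and leaves the length of
    the row it leaves behind unchanged; hence an insertion that performs [b]
    bumps creates its single new cell in row [b], rows being counted from [0]
    ([shape_rs_insert]).  Such a cell contributes exactly [b] to the weighted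
    size [\sum_i i * lambda_i] of the shape ([weight_incr_nth]), so this weight
    and the number of bumps, both [0] for the empty tableau, grow by the same
    amount at every step ([bump_rs]). *)

Definition weight (sh : seq nat) : nat := \sum_(0 <= i < size sh) i * nth 0 sh i.

(** Padding the shape with empty rows lets the sums for two shapes of different
    heights be compared over a common range. *)
Lemma weight_widen (sh : seq nat) (m : nat) :
  size sh <= m -> weight sh = \sum_(0 <= i < m) i * nth 0 sh i.
Proof.
move=> le_m; rewrite /weight (big_cat_nat _ le_m) //=.
rewrite [X in _ + X]big_nat_cond [X in _ + X]big1 ?addn0 // => i.
by case/andP=> /andP[le_i _] _; rewrite nth_default // muln0.
Qed.

Lemma weight_incr_nth (sh : seq nat) (b : nat) :
  weight (incr_nth sh b) = weight sh + b.
Proof.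
set m := size (incr_nth sh b).
have [le_sh lt_b] : size sh <= m /\ b < m.
  rewrite /m size_incr_nth; case: ifP => [//|/negbT].
  by rewrite -leqNgt => /leqW.
rewrite (weight_widen _ _ le_sh) /weight -/m addnC.
under eq_bigr => i _ do rewrite nth_incr_nth mulnDr.
rewrite big_split /=; congr (_ + _).
rewrite (bigD1_seq b) ?mem_index_iota ?iota_uniq //= eqxx muln1.
by rewrite big1 ?addn0 // => i /negPf; rewrite eq_sym => ->; rewrite muln0.
Qed.

(** When [k] cannot be appended, the row has an entry larger than [k], namely
    its last one; the bumped position therefore lies inside the row, and the
    replacement does not lengthen it. *)
Lemma size_bumped_row (r : seq nat) (k : nat) :
  (r == [::]) || (last 0 r <= k) = false ->
  size (set_nth 0 r (find (fun y => k < y) r) k) = size r.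
Proof.
case: r => [//|x s] /= /negbT; rewrite -ltnNge => lt_k.
rewrite -[if _ then _ else _]/(find (fun y => k < y) (x :: s)).
rewrite size_set_nth; apply/maxn_idPr; rewrite -has_find.
by apply/hasP; exists (last x s); rewrite ?mem_last.
Qed.

(** A bump preserves the length of its row and passes to the next one, so the
    induction on rows shifts the index of the growing row by one exactly when it
    counts one more bump.  When the insertion runs past the last row, the new
    one-cell row is what [incr_nth] appends. *)
Lemma shape_rs_insert (P : tableau) (k : nat) :
  shape (rs_insert P k).1 = incr_nth (shape P) (rs_insert P k).2.
Proof.
elim: P k => [//|r P IHP] k /=.
case: ifP => [_|bumps] /=; first by rewrite size_rcons.
have := IHP (nth 0 r (find (fun y => k < y) r)).
by case: rs_insert => P' b /= ->; rewrite size_bumped_row.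
Qed.

Lemma bump_rs (w : seq nat) : (rs w).2 = weight (shape (rs w).1).
Proof.
rewrite /rs; elim/last_ind: w => [|w k IHw]; first by rewrite /weight big_nil.
rewrite foldl_rcons; case: (foldl _ _ w) IHw => P b /= ->.
have := shape_rs_insert P k.
by case: rs_insert => P' b' /= ->; rewrite weight_incr_nth.
Qed.

Theorem proposition5 (n : nat) (hn : 1 <= n) (s : 'S_n) (lam : seq nat)
    (hlam : rs_shape s = lam) :
  rs_bump s = \sum_(1 <= i < (size lam).+1) (i - 1) * nth 0 lam (i - 1).
Proof.
rewrite -hlam /rs_bump bump_rs /weight big_add1 /=.
by apply: eq_bigr => i _; rewrite subn1.
Qed.
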